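(* Let $G$ be an infinite connected graph of maximum degree three, equipped with an arbitrary rotor mechanism. If the initial rotors are independent and uniform, then almost surely $G$ contains no infinite live path.
   Context: Graphs are undirected, with no loops or multiple edges; each edge $\{x,y\}$ gives directed edges $x\to y$ and $y\to x$. A rotor configuration assigns to each vertex $v$ a directed edge $\rho(v)$ out of $v$; a rotor mechanism specifies for each $v$ a cyclic permutation $\pi_v$ of the directed edges out of $v$. Independent uniform initial rotors: the $\rho(v)$ are independent and each is uniform among the directed edges out of $v$. A path $x_0,x_1,\dots$ is a finite or infinite sequence of distinct vertices with consecutive vertices adjacent; its internal vertices are all its vertices except the first and, for a finite path, the last. A path is live at an internal vertex $x_i$ if, in the cyclic order of $\pi_{x_i}$ beginning immediately after the initial rotor at $x_i$ (i.e. $\pi_{x_i}(\rho(x_i)),\pi_{x_i}^2(\rho(x_i)),\dots,\rho(x_i)$), the edge $x_i\to x_{i+1}$ occurs before $x_i\to x_{i-1}$. The path is live if this holds at every internal vertex. *)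

(* Defs.v *)
From HB Require Import structures.
From mathcomp Require Import all_boot all_order all_algebra.
From mathcomp Require Import finmap.
From mathcomp Require Import all_classical all_reals all_analysis.

Set Implicit Arguments.
Unset Strict Implicit.
Unset Printing Implicit Defensive.

Import Order.TTheory GRing.Theory Num.Theory.

Local Open Scope classical_set_scope.

Section Graphs.
Variable V : choiceType.

Definition simple_graph (G : rel V) : Prop := symmetric G /\ irreflexive G.

Definition connected_graph (G : rel V) : Prop :=
  forall x y, exists p : seq V, path G x p /\ last x p = y.

(* The directed edge x -> y is the pair (x, y). *)
Definition out_edges (G : rel V) (v : V) : set (V * V) :=
  [set a | a.1 = v /\ G a.1 a.2].

(* Only meaningful when [out_edges G v] is finite, since [fset_set] is empty on
   infinite sets. In a simple graph this is also the number of neighbours. *)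
Definition degree (G : rel V) (v : V) : nat := #|` fset_set (out_edges G v)|.

Definition max_degree_le (G : rel V) (k : nat) : Prop :=
  forall v, finite_set (out_edges G v) /\ (degree G v <= k)%N.

(* [f] restricts to a permutation of [A] consisting of a single cycle. *)
Definition cyclic_permutation (T : Type) (A : set T) (f : T -> T) : Prop :=
  set_bij A A f /\ forall a b, A a -> A b -> exists k, iter k f a = b.

Definition rotor_mechanism (G : rel V) (mech : V -> V * V -> V * V) : Prop :=
  forall v, cyclic_permutation (out_edges G v) (mech v).

Definition rotor_configuration (G : rel V) (rho : V -> V * V) : Prop :=
  forall v, out_edges G v (rho v).

(* The out-edges of v in the order mech(rho v), mech^2(rho v), ..., rho v. *)
Definition rotor_order (G : rel V) (mech : V -> V * V -> V * V)
    (rho : V -> V * V) (v : V) : seq (V * V) :=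
  traject (mech v) (mech v (rho v)) (degree G v).

Definition infinite_path (G : rel V) (x : nat -> V) : Prop :=
  injective x /\ forall i, G (x i) (x i.+1).

Definition live_at (G : rel V) (mech : V -> V * V -> V * V)
    (rho : V -> V * V) (prev v next : V) : Prop :=
  let s := rotor_order G mech rho v in
  (index (v, next) s < index (v, prev) s)%N.

(* The internal vertices of an infinite path are the x_(i+1). *)
Definition infinite_live_path (G : rel V) (mech : V -> V * V -> V * V)
    (rho : V -> V * V) (x : nat -> V) : Prop :=
  infinite_path G x /\
  forall i, live_at G mech rho (x i) (x i.+1) (x i.+2).

End Graphs.

Section Probability.
Context {d : measure_display} {Omega : measurableType d} {R : realType}.
Variable P : probability Omega R.

(* Measurability with respect to the discrete sigma-algebra on [T]. *)
Definition discrete_random_variable (T : Type) (X : Omega -> T) : Prop :=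
  forall B : set T, measurable (X @^-1` B).

Definition mutually_independent (I : choiceType) (T : Type)
    (X : I -> Omega -> T) : Prop :=
  forall (J : {fset I}) (B : I -> set T),
    P (\bigcap_(i in [set` J]) (X i @^-1` B i)) =
    (\prod_(i <- J) P (X i @^-1` B i))%E.

Definition uniform_on (T : choiceType) (A : set T) (X : Omega -> T) : Prop :=
  finite_set A /\
  forall a, A a -> P (X @^-1` [set a]) = ((#|` fset_set A|%:R^-1)%R%:E)%E.

Definition independent_uniform_rotors (V : choiceType) (G : rel V)
    (rho : Omega -> V -> V * V) : Prop :=
  [/\ forall w, rotor_configuration G (rho w),
      forall v, discrete_random_variable (fun w => rho w v),
      mutually_independent (fun v w => rho w v) &
      forall v, uniform_on (out_edges G v) (fun w => rho w v)].

End Probability.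

(* Main.v *)
Require Import Defs.
From HB Require Import structures.
From mathcomp Require Import all_boot all_order all_algebra.
From mathcomp Require Import finmap.
From mathcomp Require Import all_classical all_reals all_analysis.
From mathcomp Require Import zify lra.

Set Implicit Arguments.
Unset Strict Implicit.
Unset Printing Implicit Defensive.

(** Fix a starting vertex x. For a finite set B containing x, consider the
    live paths from x that stay in B until their last vertex, which lies
    outside B; the last vertices are the exits of B. Escaping B means that
    such a path exists. An infinite live path from x makes x escape every B,
    so it suffices that the neighbourhoods B_n of x satisfy
    Pr (x escapes all B_n) = 0; the starting vertices are then handled by
    countability of a connected locally finite graph.

    The count is critical. At a vertex of degree d entered from a fixed
    neighbour, the number of live continuations is the position of the entry
    edge in the rotor order, hence uniform on 0, ..., d-1, with mean
    (d-1)/2 <= 1 ([turn_count], [sum_turn_prob]). Rotors along a path of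
    distinct vertices are independent, so the expected number of live exit
    paths is at most 3, the choices for the first step ([sum_Pr_live_exit]).
    Thus B has more than n exits with probability at most 3/(n+1).

    If B has at most n exits, then given the rotors in B there is
    probability at least 3^-n that nothing goes further. At an exit v, turn
    the rotor so that the neighbours from which live paths exit B into v form
    an initial segment of the rotor order; since v has degree at most 3, every
    set of neighbours is an interval of the cyclic order at v, so this is
    possible ([initial_rotation]). A live path that exits B into v can then
    only step to a neighbour from which another live path exits B into v,
    which brings it back to B. Such an excursion can be cut out: in degree at
    most 3, if a live path C leaves a live path A for good at z, following A
    up to z and C afterwards is again live ([splice]), and the shortened path
    visits fewer exits. Hence no live path leaves B together with its
    neighbours ([no_exit_beyond]).

    Consequently p_n = Pr (x escapes B_n) satisfies, for every k,
    p_n - p_(n+1) >= 3^-k (p_n - 3/(k+1))  ([escape_drop]).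
    If all p_n stayed above some q > 0, choosing k with 3/(k+1) < q would make
    p_n decrease by a fixed amount at each step, which is absurd. *)

Local Open Scope classical_set_scope.

(** * Rotations of a finite cycle *)

Section CyclicOrder.
Variables (T : choiceType) (A : set T) (f : T -> T).
Hypotheses (fA : cyclic_permutation A f) (finA : finite_set A).

Let d := #|` fset_set A|.

Lemma cyclic_iter n e : A e -> A (iter n f e).
Proof. by case: fA => -[fun_f _ _] _ Ae; elim: n => //= n; apply: fun_f. Qed.

Lemma cyclic_iter_inj n e e' :
  A e -> A e' -> iter n f e = iter n f e' -> e = e'.
Proof.
case: fA => -[_ inj_f _] _ Ae Ae'; elim: n => //= n IHn Enn.
by apply/IHn/inj_f; rewrite ?inE//; apply: cyclic_iter.
Qed.

(** If the first [d] terms of an orbit did not already loop, the first [d + 1]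
    would be distinct elements of a set of size [d]; and an orbit that loops
    within [d] steps is contained in its first [d] terms. *)
Lemma rotation_mem e b : A e -> A b -> b \in traject f (f e) d.
Proof.
move=> Ae Ab; have Afe : A (f e) := cyclic_iter 1 Ae.
have /loopingP loop : looping f (f e) d.
  rewrite -[looping _ _ _]negbK -looping_uniq; apply/negP => uniq_t.
  have : size (traject f (f e) d.+1) <= size (fset_set A).
    apply: uniq_leq_size => // x /trajectP[i _ ->].
    by rewrite in_fset_set// inE; apply: cyclic_iter.
  by rewrite size_traject -/d ltnn.
by case: fA => _ /(_ _ _ Afe Ab)[k <-].
Qed.

Lemma rotation_uniq e : A e -> uniq (traject f (f e) d).
Proof.
move=> Ae; apply: (@leq_size_uniq _ (fset_set A)) => //.
  by move=> x; rewrite in_fset_set// inE; apply: rotation_mem.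
by rewrite size_traject.
Qed.

Lemma index_rotation e b : A e -> A b ->
  iter (index b (traject f (f e) d)) f (f e) = b.
Proof.
move=> Ae Ab; have bt := rotation_mem Ae Ab.
have := bt; rewrite -index_mem size_traject => /(nth_traject f).
by move/(_ (f e)) => <-; rewrite nth_index.
Qed.

Lemma index_rotation_lt e b : A e -> A b -> index b (traject f (f e) d) < d.
Proof.
by move=> Ae Ab; have := rotation_mem Ae Ab; rewrite -index_mem size_traject.
Qed.

Lemma index_rotation_last e : A e -> index e (traject f (f e) d) = d.-1.
Proof.
move=> Ae; have := index_rotation Ae Ae; have := index_rotation_lt Ae Ae.
set k := index _ _ => kd Ek.
case: (ltnP k.+1 d) => [ltkd|]; last by lia.
suff : 0 = k.+1 by [].
apply/eqP; rewrite -(nth_uniq (f e) _ _ (rotation_uniq Ae)) ?size_traject//;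
  last by lia.
by rewrite !nth_traject//; [rewrite /= Ek|lia].
Qed.

Lemma index_rotation_inj e b b' : A e -> A b -> A b' ->
  index b (traject f (f e) d) = index b' (traject f (f e) d) -> b = b'.
Proof. by move=> Ae Ab Ab' E; rewrite -(index_rotation Ae Ab) E index_rotation. Qed.

(** A set of at most three cyclically ordered elements has only intervals as
    subsets. The starting point [e] is chosen just before an entry into [S]: then
    the order begins in [S] and ends with [e], outside [S], which leaves one
    undecided element. Without such an entry, [S] is invariant under [f^-1]. *)
Lemma initial_rotation (S : set T) : A !=set0 -> d <= 3 ->
  exists2 e, A e & forall b c, A b -> A c -> S c ->
    index b (traject f (f e) d) < index c (traject f (f e) d) -> S b.
Proof.
case=> a0 Aa0 d3.
case: (pselect (exists e, [/\ A e, ~ S e & S (f e)])) => [[e [Ae Se Sfe]]|noe].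
  exists e => // b c Ab Ac Sc ltbc.
  have ce : index c (traject f (f e) d) <> d.-1.
    rewrite -(index_rotation_last Ae) => /(index_rotation_inj Ae Ac Ae) ce.
    by apply: Se; rewrite -ce.
  have := index_rotation_lt Ae Ac => ltc.
  have b0 : index b (traject f (f e) d) = 0 by lia.
  by rewrite -(index_rotation Ae Ab) b0.
exists a0 => // b c Ab Ac Sc _; case: fA => _ /(_ _ _ Ab Ac)[k Ek].
elim: k b Ab Ek => [|k IHk] b Ab Ek; first by rewrite -[b]/(iter 0 f b) Ek.
apply: contrapT => Sb; apply: noe; exists b; split => //.
by apply: IHk; [apply: (cyclic_iter 1 Ab)|rewrite -iterSr].
Qed.

(** Rotating the starting point moves [b] through every position exactly once:
    a uniform rotor puts a given edge at a uniform position. *)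
Lemma sum_index_rotation b : A b ->
  \sum_(e <- fset_set A) index b (traject f (f e) d) = \sum_(0 <= k < d) k.
Proof.
move=> Ab; rewrite -(big_map (fun e => index b (traject f (f e) d)) xpredT id).
apply: perm_big; rewrite /index_iota subn0.
have sub : {subset [seq index b (traject f (f e) d) | e <- fset_set A]
            <= iota 0 d}.
  move=> _ /mapP[e Ae ->]; rewrite mem_iota/=; move: Ae.
  by rewrite in_fset_set// inE => Ae; apply: index_rotation_lt.
have uniq_m : uniq [seq index b (traject f (f e) d) | e <- fset_set A].
  rewrite map_inj_in_uniq// => e e'; rewrite !in_fset_set// !inE => Ae Ae' E.
  apply: (@cyclic_iter_inj (index b (traject f (f e) d)).+1) => //.
  by rewrite !iterSr index_rotation// E index_rotation.
apply: uniq_perm => //; first exact: iota_uniq.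
by case: (uniq_min_size uniq_m sub) => //; rewrite size_map size_iota.
Qed.

End CyclicOrder.

(** * Live paths *)

Lemma split_last_has (T : eqType) (p : pred T) (s : seq T) : has p s ->
  exists s1 z s2, [/\ s = s1 ++ z :: s2, p z & ~~ has p s2].
Proof.
elim: s => //= x s IHs; case: (boolP (has p s)).
  move=> /IHs[s1 [z [s2 [-> pz ps2]]]] _.
  by exists (x :: s1), z, s2.
by move=> ps; rewrite orbF => px; exists [::], x, s.
Qed.

Lemma split_first_has (T : eqType) (p : pred T) (s : seq T) : has p s ->
  exists s1 z s2, [/\ s = s1 ++ z :: s2, p z & ~~ has p s1].
Proof.
elim: s => //= x s IHs; case: (boolP (p x)) => [px _|px /=].
  by exists [::], x, s.
case/IHs => s1 [z [s2 [-> pz ps1]]].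
by exists (x :: s1), z, s2; rewrite /= negb_or px.
Qed.

Section LivePaths.
Variables (V : choiceType) (G : rel V) (mech : V -> V * V -> V * V).
Hypotheses (sG : simple_graph G) (dG : max_degree_le G 3).

Definition out (v : V) : seq (V * V) := enum_fset (fset_set (out_edges G v)).

Lemma mem_out v e : (e \in out v) = (e.1 == v) && G v e.2.
Proof.
rewrite in_fset_set; last by case: (dG v).
apply/idP/andP; rewrite inE /out_edges /=; first by case=> <- ->.
by case=> /eqP ->.
Qed.

Lemma out_uniq v : uniq (out v). Proof. exact: fset_uniq. Qed.

(** The liveness condition at [v] for a rotor [e], the path coming from [a] and
    going on to [u]; [live_at] is this condition at [e := rho v]. *)
Definition turn v e a u : bool :=
  index (v, u) (traject (mech v) (mech v e) (degree G v)) <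
  index (v, a) (traject (mech v) (mech v e) (degree G v)).

Fixpoint live (r : V -> V * V) (s : seq V) : bool :=
  if s is a :: s' then
    (if s' is v :: u :: _ then turn v (r v) a u else true) && live r s'
  else true.

Lemma live_cat r s1 a v s2 :
  live r (s1 ++ a :: v :: s2) =
  live r (s1 ++ [:: a; v]) && live r (a :: v :: s2).
Proof.
elim: s1 => [|x s1 IHs] //=; rewrite IHs /= andbA; congr (_ && _ && _).
by case: s1 {IHs} => //= y [].
Qed.

Lemma live_prefix r s1 s2 : live r (s1 ++ s2) -> live r s1.
Proof.
elim: s1 => //= x s1 IHs /andP[lx /IHs ->]; rewrite andbT.
by case: s1 lx {IHs} => //= y [].
Qed.

Lemma live_suffix r s1 s2 : live r (s1 ++ s2) -> live r s2.
Proof. by elim: s1 => //= x s1 IHs /andP[_ /IHs]. Qed.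

Lemma live_agree r r' x s : {in belast x s, r =1 r'} ->
  live r (x :: s) = live r' (x :: s).
Proof.
elim: s x => [//|v s IHs] x rr'.
have step r0 : live r0 [:: x, v & s] =
    (if s is u :: _ then turn v (r0 v) x u else true) && live r0 (v :: s) by [].
rewrite !step IHs; last by move=> y ys; apply: rr'; rewrite inE ys orbT.
by case: s rr' {IHs step} => //= u s -> //; rewrite !inE eqxx orbT.
Qed.

Definition live_path r s := [&& sorted G s, uniq s & live r s].

Lemma live_path_prefix r s1 s2 : live_path r (s1 ++ s2) -> live_path r s1.
Proof.
case/and3P; rewrite cat_uniq => + /and3P[u1 _ _] /live_prefix l1.
by rewrite /live_path u1 l1 andbT => /cat_sorted2[-> _].
Qed.

Lemma live_path_suffix r s1 s2 : live_path r (s1 ++ s2) -> live_path r s2.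
Proof.
case/and3P; rewrite cat_uniq => + /and3P[_ _ u2] /live_suffix l2.
by rewrite /live_path u2 l2 andbT => /cat_sorted2[_ ->].
Qed.

(** Suppose that [C] enters [z] from [c] and leaves to [u], and afterwards avoids
    [A], which passes through [a, z, b]. Since [z] has at most three neighbours,
    [c] is [a] or [b]. If [c = a] the turn from [a] to [u] is that of [C]; if
    [c = b], the edge to [u] precedes the edge to [b], which precedes the edge to
    [a]. Either way, switching from [A] to [C] at [z] is a live turn. *)
Lemma splice r p a z b q c u t :
  live_path r (rcons p a ++ z :: b :: q) -> live_path r (c :: z :: u :: t) ->
  ~~ has (mem (rcons p a ++ z :: b :: q)) (u :: t) ->
  live_path r (rcons p a ++ z :: u :: t).
Proof.
move=> A C dis.
have [symG _] := sG.
have {}A : live_path r (p ++ [:: a, z, b & q]) by rewrite -cat_rcons.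
have {}dis : ~~ has (mem (p ++ [:: a, z, b & q])) (u :: t) by rewrite -cat_rcons.
case/and3P: (A) => sA uA lA; case/and3P: (C) => sC uC lC.
rewrite cat_rcons /live_path.
have [Gaz Gzb] : G a z /\ G z b.
  by case: (cat_sorted2 sA) => _ /=/and3P[].
have [Gcz Gzu] : G c z /\ G z u by move: sC => /=/and3P[].
have zE y : G z y -> (z, y) \in out z by move=> ?; rewrite mem_out eqxx.
have nu y : y \in p ++ [:: a, z, b & q] -> u != y.
  by apply: contraTneq => <-; move: dis => /=; case/norP.
have ua : u != a by apply: nu; rewrite mem_cat !inE eqxx !orbT.
have ub : u != b by apply: nu; rewrite mem_cat !inE eqxx !orbT.
have ab : a != b.
  move: uA; rewrite cat_uniq => /and3P[_ _ /=/and3P[+ _ _]].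
  by rewrite !inE !negb_or => /and3P[].
have cu : c != u by move: uC => /=/andP[]; rewrite !inE !negb_or => /and3P[].
(* Otherwise [z] would have the four distinct neighbours [a], [b], [c], [u]. *)
have cab : (c == a) || (c == b).
  apply/negPn/negP; rewrite negb_or => /andP[ca cb].
  have : size [:: (z, a); (z, b); (z, c); (z, u)] <= size (out z).
    apply: uniq_leq_size.
      rewrite /= !inE !xpair_eqE !eqxx/= !negb_or ab (eq_sym a c) ca (eq_sym a u) ua.
      by rewrite (eq_sym b c) cb (eq_sym b u) ub cu.
    by move=> e; rewrite !inE => /or4P[] /eqP ->; rewrite zE// symG.
  by move=> /= l4; have := leq_trans l4 (dG z).2.
have lau : turn z (r z) a u.
  have lab : turn z (r z) a b.
    by move: (live_suffix lA) => /= /andP[].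
  have : turn z (r z) c u by move: lC => /= /andP[].
  by case/orP: cab => /eqP -> // lbu; apply: ltn_trans lbu lab.
apply/and3P; split.
- move: sA sC; rewrite !sorted_cat_cons => /andP[-> _] /= /and3P[_ -> ->].
  by rewrite Gaz.
- have -> : p ++ [:: a, z, u & t] = (p ++ [:: a; z]) ++ u :: t by rewrite -catA.
  rewrite cat_uniq; apply/and3P; split.
  + by move: uA; rewrite -[_ ++ _]/(_ ++ [:: a; z] ++ b :: q) catA cat_uniq => /andP[].
  + apply: contraNN dis => /hasP[y yt yp]; apply/hasP; exists y => //.
    suff : y \in p ++ [:: a, z, b & q] by [].
    have : y \in p ++ [:: a; z] by [].
    by rewrite !mem_cat !inE => /or3P[] ->; rewrite ?orbT.
  + by move: uC; rewrite /= => /and3P[_ _ ->].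
- rewrite live_cat; apply/andP; split.
    by move: lA; rewrite live_cat => /andP[].
  by rewrite /= lau /=; move: lC => /= /and3P[_ -> ->].
Qed.

Definition live_exit (B : {fset V}) r x s :=
  [&& live_path r (x :: s), all (mem B) (belast x s) & last x s \notin B].

Definition exit_edge B r x y v :=
  exists t s, x :: s = t ++ [:: y; v] /\ live_exit B r x s.

Lemma first_exit B r x s : x \in B -> live_path r (x :: s) ->
  has (fun v => v \notin B) s ->
  exists s1 v s2, s = s1 ++ v :: s2 /\ live_exit B r x (rcons s1 v).
Proof.
move=> xB ls /split_first_has[s1 [v [s2 [Es vB /hasPn s1B]]]].
exists s1, v, s2; split=> //; apply/and3P; split.
- by apply: (@live_path_prefix _ _ s2); rewrite /= cat_rcons -Es.
- rewrite belast_rcons; apply/allP => y; rewrite inE => /predU1P[->//|/s1B].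
  by rewrite negbK.
- by rewrite last_rcons.
Qed.

Lemma exit_edge_rcons B r x s v :
  live_exit B r x (rcons s v) -> exit_edge B r x (last x s) v.
Proof.
move=> ls; exists (belast x s), (rcons s v); split=> //.
by rewrite -rcons_cons lastI -cats1 -cats1 -catA.
Qed.

Lemma exit_edgeP B r x y v : exit_edge B r x y v ->
  [/\ y \in B, v \notin B & G y v].
Proof.
case=> t [s [Es /and3P[ls /allP sB]]].
have -> : last x s = v by rewrite -[LHS]/(last x (x :: s)) Es last_cat.
move=> vB; split=> //.
  apply: sB; have : rcons (belast x s) (last x s) = rcons (rcons t y) v.
    by rewrite -lastI Es -!cats1 -catA.
  by case/rcons_inj => -> _; rewrite mem_rcons inE eqxx.
by move: ls => /and3P[]; rewrite Es => /cat_sorted2[_ /=/andP[]].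
Qed.

(** The hypothesis on turns says that a live path that has exited [B] into [v]
    can only turn back towards a vertex [z] from which a live path also exits
    into [v]. A live path [s] exiting [B'] can then be shortened: with [v] its
    first vertex outside [B] and [y'] the next one, take a live path [a] exiting
    [B] through [y'] and [v], and follow [a], inside [B], up to the last
    intersection of [s] with it. The result still exits [B'], but it visits at
    least one exit of [B] less, namely [v]. *)
Lemma no_exit_beyond B B' r x : x \in B -> {subset B <= B'} ->
  (forall v u, v \in B -> G v u -> u \in B') ->
  (forall y v z, exit_edge B r x y v -> G v z -> turn v (r v) y z ->
    exit_edge B r x z v) ->
  forall s, ~~ live_exit B' r x s.
Proof.
move=> xB BB' nbrB' closed s; apply/negP.
pose X v := `[< exists y, exit_edge B r x y v >].
have XB v : X v -> v \notin B by move=> /asboolP[y /exit_edgeP[]].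
have [n] := ubnP (count X s); elim: n s => // n IHn s ltn /and3P[ls sB' lsB'].
have : has (fun v => v \notin B) s.
  case/lastP: s lsB' {ls sB' ltn} => [|s v]; first by rewrite (BB' _ xB).
  rewrite last_rcons has_rcons => vB'; apply/orP; left.
  by apply: contraNN vB' => /BB'.
case/(first_exit xB ls) => s1 [v [s2 [Es ls1]]].
have /and3P[_ s1B vB] := ls1.
have := exit_edge_rcons ls1; set y := last x s1 => yv.
have [yB _ Gyv] := exit_edgeP yv.
have vB' := nbrB' _ _ yB Gyv.
case: s2 Es => [|y' s3] Es.
  by move: lsB'; rewrite Es last_cat /= vB'.
have turn_v : turn v (r v) y y'.
  have : live r (belast x s1 ++ [:: y, v, y' & s3]).
    by move: ls => /and3P[_ _]; rewrite Es -(cat_cons x) (lastI x) cat_rcons.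
  by move=> /live_suffix /= /andP[].
have Gvy' : G v y'.
  by move: ls => /and3P[+ _ _]; rewrite Es /= cat_path => /andP[_ /=/andP[_ /andP[]]].
have [t [a [Ea la]]] := closed _ _ _ yv Gvy' turn_v.
have /and3P[lpa aB _] := la.
have [y'B _ _] : [/\ y' \in B, v \notin B & G y' v].
  by apply: (@exit_edgeP B r x); exists t, a.
have Es' : x :: s = (x :: s1) ++ [:: v, y' & s3] by rewrite Es.
have us : uniq (x :: s) by case/and3P: ls.
have tB : {subset rcons t y' <= B}.
  have -> : rcons t y' = belast x a.
    have : rcons (belast x a) (last x a) = rcons (rcons t y') v.
      by rewrite -lastI Ea -!cats1 -catA.
    by case/rcons_inj.
  by move/allP: aB.
(* [z] is the last vertex on [s] of the part of [a] inside [B]; it is not [x],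
   where [s] starts, so [a] has a predecessor [a0] of [z], and as [v] comes after
   [z] on [a] there is also a successor [b]. *)
have : has (mem (rcons t y')) (y' :: s3).
  by rewrite /= mem_rcons inE eqxx.
case/split_last_has => q1 [z [q2 [Eq zt q2t]]].
have zB : z \in B by apply: tB.
have zs3 : z \in y' :: s3 by rewrite Eq mem_cat inE eqxx orbT.
have zx : z != x.
  move: us => /= /andP[xs _]; apply: contraNneq xs => <-.
  by rewrite Es mem_cat inE zs3 !orbT.
have [p [q' Ep]] : exists p q', rcons t y' = p ++ z :: q'.
  by case/splitPr: (zt : z \in rcons t y') => p q'; exists p, q'.
have [b [q Eb]] : exists b q, rcons q' v = b :: q.
  by case: (q') => [|b q]; [exists v, [::]|exists b, (rcons q v)].
have Eav : x :: a = rcons (rcons t y') v by rewrite Ea -!cats1 -catA.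
have Epz : x :: a = p ++ [:: z, b & q] by rewrite Eav Ep rcons_cat /= Eb.
have [pn [a0 [p0 [Epn Ep0]]]] : exists pn a0 p0, p = x :: pn /\ p = rcons p0 a0.
  case: (p) Epz => [|x' pn] [Ex _]; first by rewrite Ex eqxx in zx.
  by exists pn, (last x' pn), (belast x' pn); rewrite -lastI -Ex.
have pnB : {subset x :: pn <= B}.
  by move=> c cp; apply: tB; rewrite Ep Epn mem_cat cp.
case: q2 q2t Eq => [|u w] q2t Eq.
  move: lsB'; rewrite Es last_cat /= -[last _ _]/(last v (y' :: s3)) Eq.
  by rewrite last_cat /= (BB' _ zB).
have Ec : x :: s = ((x :: s1) ++ belast v q1) ++ [:: last v q1, z, u & w].
  by rewrite Es' Eq -(cat_cons v) (lastI v) cat_rcons catA.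
have lc : live_path r [:: last v q1, z, u & w].
  by apply: (@live_path_suffix _ ((x :: s1) ++ belast v q1)); rewrite -Ec.
have vuw : v \notin u :: w.
  move: us; rewrite Es' Eq cat_uniq => /and3P[_ _ /= /andP[+ _]].
  by apply: contraNN => vuw; rewrite mem_cat inE vuw !orbT.
(* The shortened path: [a] up to [z], then [s]. *)
have ln : live_path r (x :: pn ++ [:: z, u & w]).
  rewrite -cat_cons -Epn Ep0; apply: (splice (b := b) (q := q) _ lc).
    by rewrite -Ep0 -Epz.
  rewrite -Ep0 -Epz Eav; apply/hasPn => c cuw; rewrite /= mem_rcons inE negb_or.
  apply/andP; split; first by apply: contraNneq vuw => <-.
  by move/hasPn/(_ c cuw): q2t.
have lastE : last x s = last u w.
  by rewrite Es last_cat /= -[last _ _]/(last v (y' :: s3)) Eq last_cat.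
have : live_exit B' r x (pn ++ [:: z, u & w]).
  apply/and3P; split=> //; last by rewrite last_cat /= -lastE.
  apply/allP => c; rewrite belast_cat mem_cat => /orP[cp|].
    by apply/BB'/pnB; rewrite (lastI x) mem_rcons inE cp orbT.
  rewrite /= inE => /predU1P[->|]; first by apply/BB'/pnB; rewrite mem_last.
  rewrite inE => /predU1P[->|cuw]; first by apply: BB'.
  apply: (allP sB'); have : c \in belast x (s1 ++ v :: q1 ++ [:: z, u & w]).
    by rewrite belast_cat mem_cat /= inE belast_cat mem_cat /= !inE cuw !orbT.
  by rewrite -Eq -Es.
apply: IHn; rewrite ltnS in ltn; apply: leq_trans ltn.
have pn0 : count X pn = 0.
  apply/eqP; rewrite -leqn0 leqNgt -has_count; apply/hasPn => c cp.
  by apply/negP => /XB/negP; apply; apply: pnB; rewrite inE cp orbT.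
have Xz : X z = false by apply/negP => /XB/negP.
rewrite Es Eq !count_cat /=.
have -> : X v by apply/asboolP; exists y.
by rewrite pn0 Xz /= !add0n add1n addnS ltnS count_cat /= Xz add0n addnA leq_addl.
Qed.

Lemma live_exit_agree B r r' x s : {in B, r =1 r'} ->
  live_exit B r x s = live_exit B r' x s.
Proof.
move=> rr'; rewrite /live_exit; case: (boolP (all _ _)) => [/allP sB|];
  last by rewrite !andbF.
by rewrite /live_path (@live_agree r r')// => y /sB /rr'.
Qed.

Lemma exit_edge_agree B r r' x : {in B, r =1 r'} ->
  exit_edge B r x = exit_edge B r' x.
Proof.
move=> rr'; apply/funext => y; apply/funext => v; apply/propext.
by split=> -[t [s [Es ls]]]; exists t, s;
  rewrite ?(live_exit_agree _ _ rr')// -(live_exit_agree _ _ rr').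
Qed.

Definition nbrs v : seq V := [seq e.2 | e <- out v].

Lemma mem_nbrs v u : (u \in nbrs v) = G v u.
Proof.
apply/mapP/idP => [[e + ->]|Gvu]; first by rewrite mem_out => /andP[].
by exists (v, u) => //; rewrite mem_out eqxx.
Qed.

(** A finite list of candidates for the live exit paths. Walks may repeat
    vertices: this only enlarges the sum of weights to be bounded, and makes
    that sum computable by recursion. *)
Fixpoint exit_walks (B : {fset V}) n v : seq (seq V) :=
  if v \notin B then [:: [::]] else
  if n is m.+1 then [seq u :: s | u <- nbrs v, s <- exit_walks B m u]
  else [::].

Lemma exit_walks_complete (B : {fset V}) n v s : path G v s ->
  all (mem B) (belast v s) -> last v s \notin B -> size s <= n ->
  s \in exit_walks B n v.
Proof.
elim: n v s => [|n IHn] v [|u s] //=; try by move=> _ _ ->.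
move=> /andP[Gvu us] /andP[vB usB] lB ltsn; rewrite (vB : v \in B) /=.
by apply/allpairsPdep; exists u, s; rewrite mem_nbrs Gvu IHn.
Qed.

Definition live_exits (B : {fset V}) r x : seq (seq V) :=
  [seq s <- exit_walks B #|` B| x | live_exit B r x s].

(** The fuel suffices because the vertices of the path before its exit are
    distinct elements of [B]. *)
Lemma mem_live_exits B r x s : (s \in live_exits B r x) = live_exit B r x s.
Proof.
rewrite mem_filter; case: (boolP (live_exit _ _ _ _)) => //= /and3P[+ sB lB].
case/and3P => ps us _; apply: exit_walks_complete => //.
rewrite -(size_belast x); apply: uniq_leq_size; last by apply/allP.
by move: us; rewrite lastI rcons_uniq => /andP[].
Qed.

Definition exits (B : {fset V}) r x : seq V :=
  undup [seq last x s | s <- live_exits B r x].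

Lemma size_exits B r x : size (exits B r x) <= size (live_exits B r x).
Proof. by rewrite (leq_trans (size_undup _))// size_map. Qed.

Lemma exits_agree B r r' x : {in B, r =1 r'} -> exits B r x = exits B r' x.
Proof.
move=> rr'; congr (undup (map _ _)); apply: eq_filter => s.
exact: live_exit_agree.
Qed.

Lemma exits_notin B r x v : v \in exits B r x -> v \notin B.
Proof.
by rewrite mem_undup => /mapP[s + ->]; rewrite mem_live_exits => /and3P[].
Qed.

Lemma exit_edge_exits B r x y v : exit_edge B r x y v -> v \in exits B r x.
Proof.
case=> t [s [Es ls]]; rewrite mem_undup; apply/mapP; exists s.
  by rewrite mem_live_exits.
by rewrite -[RHS]/(last x (x :: s)) Es last_cat.
Qed.

Hypothesis mG : rotor_mechanism G mech.

Lemma fin_out v : finite_set (out_edges G v). Proof. by case: (dG v). Qed.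

(** With rotor [e] at [v], the neighbours in [S] come first in the rotor order, so
    a path entering [v] from [S] is sent back to [S]. *)
Definition blocks v (S : set V) e :=
  forall y z, G v y -> G v z -> S y -> turn v e y z -> S z.

Definition blocker v (S : set V) : V * V :=
  xget (v, v) [set e | out_edges G v e /\ blocks v S e].

Lemma blockerP v S : out_edges G v !=set0 ->
  out_edges G v (blocker v S) /\ blocks v S (blocker v S).
Proof.
move=> v0; rewrite /blocker; apply: (@xgetPex _ (v, v)
  [set e | out_edges G v e /\ blocks v S e]).
have [e ve Se] := initial_rotation (mG v) (fin_out v) (fun e => S e.2) v0 (dG v).2.
by exists e; split=> // y z Gvy Gvz Sy; apply: (Se (v, z) (v, y)).
Qed.

Lemma blocked_no_exit B B' r x : rotor_configuration G r ->
  x \in B -> {subset B <= B'} ->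
  (forall v u, v \in B -> G v u -> u \in B') ->
  (forall v, v \in exits B r x ->
    r v = blocker v [set y | exit_edge B r x y v]) ->
  forall s, ~~ live_exit B' r x s.
Proof.
move=> cr xB BB' nbrB' rb; apply: (no_exit_beyond xB BB' nbrB') => y v z yv Gvz.
rewrite rb; last exact: exit_edge_exits yv.
have [|_ +] := @blockerP v [set y | exit_edge B r x y v].
  by exists (r v); apply: cr.
apply=> //; have [_ _] := exit_edgeP yv; by case: sG => ->.
Qed.

(** Entering from [a] with rotor [e], the number of live continuations is the
    position of [(v, a)] in the rotor order. Over all [e] these positions are
    0, ..., d-1, whose sum d(d-1)/2 is at most d because d <= 3. *)
Lemma turn_count v a : G v a ->
  \sum_(u <- nbrs v) \sum_(e <- out v) (turn v e a u : nat) <= degree G v.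
Proof.
move=> Gva; rewrite exchange_big /=.
apply: (@leq_trans (\sum_(e <- out v) index (v, a)
    (traject (mech v) (mech v e) (degree G v)))).
  rewrite !big_seq; apply: leq_sum => e; rewrite mem_out => /andP[/eqP e1 Ge].
  have Ae : out_edges G v e by split=> //; rewrite e1.
  rewrite big_map; set o := traject _ _ _.
  have -> : \sum_(e' <- out v) (turn v e a e'.2 : nat) =
      size [seq e' <- out v | turn v e a e'.2].
    rewrite size_filter -sum1_count [RHS]big_mkcond.
    by apply: eq_bigr => e' _; case: turn.
  apply: leq_trans (_ : size (take (index (v, a) o) o) <= _); last first.
    by rewrite size_take; case: ltnP.
  apply: uniq_leq_size => [|e']; first exact: filter_uniq (out_uniq v).
  rewrite mem_filter mem_out => /and3P[te' /eqP e1' Ge'].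
  have Ae' : out_edges G v e' by split=> //; rewrite e1'.
  rewrite in_take; first by rewrite [e']surjective_pairing e1'.
  exact: (rotation_mem (mG v) (fin_out v)).
rewrite (sum_index_rotation (mG v) (fin_out v))//.
have := (dG v).2; rewrite /degree; case: #|` _| => [|[|[|[|]]]]//= _;
  by rewrite unlock.
Qed.

Lemma infinite_live_path_exits r (x : nat -> V) (B : {fset V}) :
  infinite_live_path G mech r x -> x 0 \in B -> exists s, live_exit B r (x 0) s.
Proof.
move=> [[injx Gx] lx] x0B; pose s k n := [seq x i | i <- iota k n].
have lives : forall n k, live r (s k n).
  elim=> //= n IHn k; rewrite IHn andbT.
  by case: n {IHn} => //= -[|n] //=; apply: lx.
have paths : forall n k, path G (x k) (s k.+1 n).
  by elim=> //= n IHn k; rewrite Gx IHn.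
have uniqs n : uniq (s 0 n) by rewrite map_inj_uniq ?iota_uniq.
have lps : live_path r (x 0 :: s 1 #|` B|).
  by apply/and3P; split;
    [apply: paths|apply: (uniqs #|` B|.+1)|apply: (lives #|` B|.+1 0)].
have [|s1 [v [_ [_ ls]]]] := first_exit x0B lps; last by exists (rcons s1 v).
apply/negPn/negP => /hasPn sB.
have : size (s 0 #|` B|.+1) <= #|` B|.
  apply: uniq_leq_size => // y; rewrite inE => /predU1P[->//|/sB].
  by rewrite negbK.
by rewrite size_map size_iota ltnn.
Qed.

End LivePaths.

(** * Independent rotors *)

Section RandomRotors.
Import Order.TTheory GRing.Theory Num.Theory.
Local Open Scope ring_scope.
Context {d : measure_display} {Omega : measurableType d} {R : realType}.
Variable P : probability Omega R.

Definition Pr (A : set Omega) : R := fine (P A).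

Lemma PrE A : measurable A -> P A = (Pr A)%:E.
Proof. by move=> mA; rewrite /Pr fineK// fin_num_measure. Qed.

Lemma Pr_ge0 A : 0 <= Pr A.
Proof. by rewrite /Pr fine_ge0. Qed.

Lemma Pr_le1 A : measurable A -> Pr A <= 1.
Proof. by move=> mA; rewrite -lee_fin -PrE// probability_le1. Qed.

Lemma Pr0 : Pr set0 = 0. Proof. by rewrite /Pr measure0. Qed.

Lemma Pr_le A B : measurable A -> measurable B -> A `<=` B -> Pr A <= Pr B.
Proof.
by move=> mA mB AB; rewrite -lee_fin -!PrE//; apply: le_measure; rewrite ?inE.
Qed.

Lemma PrU A B : measurable A -> measurable B -> A `&` B = set0 ->
  Pr (A `|` B) = Pr A + Pr B.
Proof.
move=> mA mB AB; apply/EFin_inj; rewrite EFinD -!PrE ?measureU//.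
exact: measurableU.
Qed.

Lemma Pr_split A B : measurable A -> measurable B ->
  Pr A = Pr (A `&` B) + Pr (A `\` B).
Proof.
move=> mA mB; rewrite -PrU; [|exact: measurableI|exact: measurableD|].
  by rewrite setDE -setIUr setUv setIT.
by rewrite setDE setIACA setICr setI0.
Qed.

(** Markov's inequality for a number of events. The proof is by induction on
    the list, splitting [F] along the first event: on it one occurrence fewer
    is required of the remaining events. *)
Lemma Pr_count (T : Type) (l : seq T) (E : T -> Omega -> bool) k F :
  (forall s, measurable [set w | E s w]) -> measurable F ->
  (forall w, F w -> (k <= count (E^~ w) l)%N) ->
  k%:R * Pr F <= \sum_(s <- l) Pr (F `&` [set w | E s w]).
Proof.
move=> mE; elim: l k F => [|s l IHl] k F mF kF.
  rewrite big_nil; case: (pselect (F = set0)) => [->|]; first by rewrite Pr0 mulr0.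
  by move/eqP/set0P => [w /kF] /=; case: k {kF} => //; rewrite mul0r.
have mI := measurableI _ _ mF (mE s); have mD := measurableD mF (mE s).
rewrite big_cons.
have -> : \sum_(t <- l) Pr (F `&` [set w | E t w]) =
    \sum_(t <- l) Pr ((F `&` [set w | E s w]) `&` [set w | E t w]) +
    \sum_(t <- l) Pr ((F `\` [set w | E s w]) `&` [set w | E t w]).
  rewrite -big_split; apply: eq_bigr => t _ /=.
  rewrite (@Pr_split _ [set w | E s w])//; last exact: measurableI.
  by congr (Pr _ + Pr _); rewrite ?setDE setIAC.
have leD := IHl k _ mD; have leI := IHl k.-1 _ mI.
rewrite (Pr_split mF (mE s)) mulrDr addrA lerD//; last first.
  apply: leD => w [/kF /= + /negP/negbTE Es]; by rewrite Es.
have {}leI := leI _; apply: le_trans (_ : Pr (F `&` [set w | E s w]) +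
  k.-1%:R * Pr (F `&` [set w | E s w]) <= _); last first.
  by rewrite lerD2l leI// => w [/kF /= + Es]; rewrite Es; case: (k).
case: (k) => [|m]; first by rewrite !mul0r addr0 Pr_ge0.
by rewrite -natr1 mulrDl mul1r addrC.
Qed.

Variables (V : choiceType) (G : rel V) (mech : V -> V * V -> V * V).
Variable rho : Omega -> V -> V * V.
Hypotheses (sG : simple_graph G) (dG : max_degree_le G 3).
Hypotheses (mG : rotor_mechanism G mech).
Hypothesis rhoU : independent_uniform_rotors P G rho.

Lemma measurable_rotor v (S : set (V * V)) : measurable [set w | S (rho w v)].
Proof. by case: rhoU => _ + _ _ => /(_ v S). Qed.

Lemma measurable_rotors (s : seq V) (S : V -> set (V * V)) :
  measurable [set w | forall v, v \in s -> S v (rho w v)].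
Proof.
elim: s => [|v s IHs].
  by rewrite (_ : [set w | _] = setT)//; apply/seteqP; split => // w _ u.
rewrite (_ : [set w | _] = [set w | S v (rho w v)] `&`
    [set w | forall v, v \in s -> S v (rho w v)]).
  by apply: measurableI => //; apply: measurable_rotor.
apply/seteqP; split => w /=.
  by move=> H; split=> [|u us]; apply: H; rewrite inE ?eqxx ?us ?orbT.
by move=> [Sv H] u; rewrite inE => /predU1P[->//|/H].
Qed.

Lemma Pr_independent (s : seq V) (S : V -> set (V * V)) : uniq s ->
  Pr [set w | forall v, v \in s -> S v (rho w v)] =
  \prod_(v <- s) Pr [set w | S v (rho w v)].
Proof.
case: rhoU => _ _ ind _ us; apply/EFin_inj; rewrite -prodEFin.
have := ind [fset v in s]%fset S.
have -> : \bigcap_(i in [set` [fset v in s]%fset]) ((rho^~ i) @^-1` S i) =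
    [set w | forall v, v \in s -> S v (rho w v)].
  by apply/seteqP; split => w H v vs; apply: H; move: vs; rewrite /= inE.
rewrite -PrE; last exact: measurable_rotors.
move=> ->; rewrite (perm_big s) /=; last first.
  by apply: uniq_perm => // v; rewrite inE.
by apply: eq_bigr => v _; rewrite PrE//; apply: measurable_rotor.
Qed.

Definition cyl (J : seq V) (r : V -> V * V) : set Omega :=
  [set w | {in J, rho w =1 r}].

Lemma Pr_split_rotor v F : measurable F ->
  Pr F = \sum_(e <- out G v) Pr (F `&` [set w | rho w v = e]).
Proof.
move=> mF.
have H (l : seq (V * V)) : uniq l -> Pr (F `&` [set w | rho w v \in l]) =
    \sum_(e <- l) Pr (F `&` [set w | rho w v = e]).
  have mI (S : set (V * V)) : measurable (F `&` [set w | S (rho w v)]).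
    by apply: measurableI => //; apply: measurable_rotor.
  elim: l => [|e l IHl] /=.
    rewrite big_nil (_ : _ `&` _ = set0) ?Pr0//.
    by apply/seteqP; split => w [].
  move=> /andP[el ul]; rewrite big_cons -IHl// -PrU; last first.
  - by apply/seteqP; split => w // [[_ /= ->] [_ /=]]; rewrite (negbTE el).
  - exact: (mI [set e' | e' \in l]).
  - exact: (mI [set e]).
  congr Pr; apply/seteqP; split => w.
    by move=> [Fw]; rewrite /= inE => /predU1P[->|wl]; [left|right].
  by move=> [[Fw /= ->]|[Fw /= wl]]; split => //=; rewrite inE ?eqxx ?wl ?orbT.
rewrite -H ?out_uniq//; congr Pr; apply/seteqP; split => w; last by case.
move=> Fw; split=> //=; case: rhoU => /(_ w v) [vE Ge] _ _ _.
by rewrite mem_out// vE eqxx; move: Ge; rewrite vE.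
Qed.

Lemma measurable_cyl J r : measurable (cyl J r).
Proof. exact: (measurable_rotors J (fun v => [set r v])). Qed.

Lemma cyl_consE v J r w0 : rho w0 v = r v ->
  cyl (v :: J) r = [set w | rho w v = rho w0 v] `&` cyl J r.
Proof.
move=> E; apply/seteqP; split => w /=.
  by move=> H; split=> [|u uJ]; rewrite ?E; apply: H; rewrite inE ?eqxx ?uJ ?orbT.
by rewrite E => -[rv H] u; rewrite inE => /predU1P[->//|/H].
Qed.

(** Conditioning on finitely many rotors: as they take finitely many values, an
    inequality linear in the probabilities follows from its restrictions to
    the events on which the rotors in [J] have given values. Only realised
    values [rho w0] have to be considered. *)
Lemma Pr_le_cylinders J (a b : R) F F' : 0 <= b ->
  measurable F -> measurable F' ->
  (forall w0,
    a * Pr (F `&` cyl J (rho w0)) <= b * Pr (F' `&` cyl J (rho w0))) ->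
  a * Pr F <= b * Pr F'.
Proof.
move=> b0; elim: J F F' => [|v J IHJ] F F' mF mF' H.
  case: (pselect (exists w : Omega, True)) => [[w0 _]|no].
    have cylT : cyl [::] (rho w0) = setT by apply/seteqP; split => // w _ u.
    by have := H w0; rewrite cylT !setIT.
  have -> : F = set0 by apply/seteqP; split => // w; case: no; exists w.
  by rewrite Pr0 mulr0 mulr_ge0 ?Pr_ge0.
have mv e : measurable [set w | rho w v = e] := measurable_rotor v [set e].
rewrite (Pr_split_rotor v mF) (Pr_split_rotor v mF') !mulr_sumr.
apply: ler_sum => e _; apply: IHJ => [||w0]; try exact: measurableI.
(* A value [e] incompatible with the cylinder of [w0] contributes nothing;
   a compatible one is realised together with it by some [w1]. *)
set A := (X in a * Pr X <= _); case: (pselect (A = set0)) => [->|].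
  by rewrite Pr0 mulr0 mulr_ge0 ?Pr_ge0.
move=> /eqP/set0P[w1 [[_ /= we] wJ]].
have -> : A = F `&` cyl (v :: J) (rho w1).
  rewrite (@cyl_consE _ _ _ w1)// we setIA /A; congr (_ `&` _).
  by apply/seteqP; split => w H' u uJ; rewrite H' ?wJ.
have -> : (F' `&` [set w | rho w v = e]) `&` cyl J (rho w0) =
    F' `&` cyl (v :: J) (rho w1).
  rewrite (@cyl_consE _ _ _ w1)// we setIA; congr (_ `&` _).
  by apply/seteqP; split => w H' u uJ; rewrite H' ?wJ.
exact: H.
Qed.

Lemma measurable_cylinders J F :
  (forall w0, measurable (F `&` cyl J (rho w0))) -> measurable F.
Proof.
elim: J F => [|v J IHJ] F H.
  case: (pselect (F = set0)) => [->//|/eqP/set0P[w0 _]].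
  have cylT : cyl [::] (rho w0) = setT by apply/seteqP; split => // w _ u.
  by have := H w0; rewrite cylT setIT.
have -> : F = \bigcup_(e in out_edges G v) (F `&` [set w | rho w v = e]).
  apply/seteqP; split => w; last by case=> e _ [].
  by move=> Fw; exists (rho w v) => //; case: rhoU => /(_ w v).
apply: fin_bigcup_measurable => [|e _]; first by case: (dG v).
apply: IHJ => w0; set A := (X in measurable X).
case: (pselect (A = set0)) => [->//|/eqP/set0P[w1 [[_ /= we] wJ]]].
have -> : A = F `&` cyl (v :: J) (rho w1); last exact: H.
rewrite (@cyl_consE _ _ _ w1)// we setIA /A; congr (_ `&` _).
by apply/seteqP; split => w H' u uJ; rewrite H' ?wJ.
Qed.

Definition determined_by (J : seq V) (A : set (V -> V * V)) :=
  forall r r', {in J, r =1 r'} -> A r -> A r'.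

Lemma determined_cyl J A w0 : determined_by J A ->
  [set w | A (rho w)] `&` cyl J (rho w0) =
  if `[< A (rho w0) >] then cyl J (rho w0) else set0.
Proof.
move=> dA; apply/seteqP; split => w.
  move=> [/= Aw wJ]; case: asboolP => //; apply; exact: dA wJ Aw.
case: asboolP => //= Aw0 wJ; split=> //=; apply: dA Aw0 => v vJ.
by rewrite wJ.
Qed.

Lemma measurable_determined J A : determined_by J A ->
  measurable [set w | A (rho w)].
Proof.
move=> dA; apply: (@measurable_cylinders J) => w0; rewrite determined_cyl//.
by case: asboolP => // _; apply: measurable_cyl.
Qed.

Lemma Pr_cyl J r : uniq J ->
  Pr (cyl J r) = \prod_(v <- J) Pr [set w | rho w v = r v].
Proof. exact: (@Pr_independent J (fun v => [set r v])). Qed.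

Lemma Pr_determined_rotor J A v S : uniq J -> v \notin J -> determined_by J A ->
  Pr ([set w | A (rho w)] `&` [set w | S (rho w v)]) <=
  Pr [set w | S (rho w v)] * Pr [set w | A (rho w)].
Proof.
move=> uJ vJ dA; have mA := measurable_determined dA.
have mS := measurable_rotor v S.
rewrite -[leLHS]mul1r; apply: (@Pr_le_cylinders J) => [|||w0].
- exact: Pr_ge0.
- exact: measurableI.
- exact: mA.
rewrite mul1r setIAC determined_cyl//; case: asboolP => _; last first.
  by rewrite set0I !Pr0 mulr0.
rewrite Pr_cyl//.
have := @Pr_independent (v :: J) (fun u => if u == v then S else [set rho w0 u]).
rewrite /= vJ uJ => /(_ isT); rewrite big_cons eqxx => E.
rewrite le_eqVlt; apply/orP; left; apply/eqP.
rewrite (_ : _ `&` _ = [set w | forall u, u \in v :: J ->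
  (if u == v then S else [set rho w0 u]) (rho w u)]); last first.
  apply/seteqP; split => w /=.
    move=> [H Sw] u; rewrite inE; case: eqP => [->//|_ /=]; exact: H.
  move=> H; split=> [u uJ'|]; last by have := H v; rewrite inE eqxx; apply.
  have := H u; rewrite inE uJ' orbT => /(_ isT); case: eqP => // uv.
  by move: vJ; rewrite -uv uJ'.
rewrite E; congr (_ * _); apply: eq_big_seq => u uJ'.
by case: eqP => // uv; move: vJ; rewrite -uv uJ'.
Qed.

Lemma Pr_rotor v e : out_edges G v e ->
  Pr [set w | rho w v = e] = (degree G v)%:R^-1.
Proof. by case: rhoU => _ _ _ /(_ v)[_ +] ve => /(_ e ve); rewrite /Pr => ->. Qed.

Lemma degree_gt0 v e : out_edges G v e -> (0 < degree G v)%N.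
Proof.
move=> [vE Ge]; rewrite -(@has_predT _ (out G v)); apply/hasP; exists e => //.
by rewrite mem_out// vE eqxx -vE.
Qed.

Lemma Pr_rotor_ge v e : out_edges G v e -> 3^-1 <= Pr [set w | rho w v = e].
Proof.
move=> ve; rewrite Pr_rotor// lef_pV2 ?posrE ?ltr0n ?(degree_gt0 ve)//.
by rewrite ler_nat; case: (dG v).
Qed.

(** The vertices [H] and the prescribed rotors [k] are read off the rotors in
    [J], but [H] avoids [J]; so, given the rotors in [J], at most [n] fresh
    rotors take prescribed values, each with probability at least 1/3. *)
Lemma Pr_block J A (H : (V -> V * V) -> seq V)
    (k : (V -> V * V) -> V -> V * V) n :
  uniq J -> determined_by J A ->
  (forall r r', {in J, r =1 r'} -> H r = H r' /\ k r = k r') ->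
  (forall r, [/\ uniq (H r), {in H r, forall v, v \notin J} &
                (A r -> size (H r) <= n)%N]) ->
  (forall w v, v \in H (rho w) -> out_edges G v (k (rho w) v)) ->
  measurable [set w | {in H (rho w), rho w =1 k (rho w)}] /\
  3^-1 ^+ n * Pr [set w | A (rho w)] <=
  Pr ([set w | A (rho w)] `&`
      [set w | {in H (rho w), rho w =1 k (rho w)}]).
Proof.
move=> uJ dA Hk HP kP; have mA := measurable_determined dA.
have blockE w0 :
    [set w | {in H (rho w), rho w =1 k (rho w)}] `&` cyl J (rho w0) =
    cyl (H (rho w0) ++ J) (fun v => if v \in J then rho w0 v else k (rho w0) v).
  have [_ HJ _] := HP (rho w0); apply/seteqP; split => w.
    move=> [/= Hw wJ] v; have [EH Ek] := Hk _ _ wJ; rewrite mem_cat.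
    case: ifPn => [vJ _|vJ]; first exact: wJ.
    by rewrite orbF -EH -Ek; apply: Hw.
  move=> H'; have wJ : {in J, rho w =1 rho w0}.
    by move=> v vJ; rewrite H' ?vJ// mem_cat vJ orbT.
  split=> //= v; have [-> ->] := Hk _ _ wJ => vH.
  by rewrite H' ?mem_cat ?vH// (negbTE (HJ _ vH)).
have mB : measurable [set w | {in H (rho w), rho w =1 k (rho w)}].
  apply: (@measurable_cylinders J) => w0; rewrite blockE; apply: measurable_cyl.
split=> //; rewrite -[leRHS]mul1r; apply: (@Pr_le_cylinders J) => // [|w0].
  exact: measurableI.
rewrite mul1r -setIA blockE.
rewrite determined_cyl//; case: asboolP => [Aw0|_]; last first.
  by rewrite Pr0 mulr0 Pr_ge0.
have [uH HJ /(_ Aw0) sH] := HP (rho w0).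
pose r := fun v => if v \in J then rho w0 v else k (rho w0) v.
rewrite [X in _ <= Pr X](_ : _ = cyl (H (rho w0) ++ J) r).
  rewrite !Pr_cyl//; last first.
    rewrite cat_uniq uH uJ andbT /=; apply/hasPn => v vJ.
    by apply/negP => /HJ; rewrite vJ.
  rewrite big_cat /= [X in _ <= _ * X](_ : _ =
      \prod_(v <- J) Pr [set w | rho w v = rho w0 v]); last first.
    by apply: eq_big_seq => v vJ; rewrite /r vJ.
  apply: ler_wpM2r; first by apply: prodr_ge0 => v _; apply: Pr_ge0.
  apply: (@le_trans _ _ (3^-1 ^+ size (H (rho w0)))).
    by rewrite ler_wiXn2l ?invr_ge0 ?invf_le1 ?ler1n ?ltr0n.
  have : {subset H (rho w0) <= H (rho w0)} by [].
  elim: {1 3 4}(H (rho w0)) => [|v s IHs] sub; first by rewrite big_nil.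
  have vH : v \in H (rho w0) by apply: sub; rewrite inE eqxx.
  rewrite /= exprS big_cons ler_pM ?invr_ge0 ?exprn_ge0//.
    by rewrite /r (negbTE (HJ _ vH)); apply/Pr_rotor_ge/kP.
  by apply: IHs => u us; apply: sub; rewrite inE us orbT.
apply/seteqP; split => w; first by case.
move=> H'; split=> //=; apply: dA Aw0 => v vJ.
by rewrite H' ?mem_cat ?vJ ?orbT// /r vJ.
Qed.

(** * The expected number of live exit paths *)

Definition turn_prob v a u : R := Pr [set w | turn G mech v (rho w v) a u].

Fixpoint walk_weight a v s : R :=
  if s is u :: s' then turn_prob v a u * walk_weight v u s' else 1.

Lemma walk_weight_ge0 a v s : 0 <= walk_weight a v s.
Proof. by elim: s a v => //= u s IHs a v; rewrite mulr_ge0 ?Pr_ge0. Qed.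

Lemma live_determined a v s :
  determined_by (v :: s) (fun r => live G mech r [:: a, v & s]).
Proof.
move=> r r' rr' /=; rewrite -!/(live _ _ _ (v :: s)) => /andP[lv ls].
apply/andP; split; last first.
  by rewrite -(@live_agree _ _ _ r)// => u us; apply/rr'/mem_belast.
by case: s rr' lv {ls} => // u s rr'; rewrite rr' ?inE ?eqxx.
Qed.

(** The rotor at [v] is independent of the rotors at the later vertices, which
    are different from [v]. *)
Lemma Pr_live_le a v s : uniq (v :: s) ->
  Pr [set w | live G mech (rho w) [:: a, v & s]] <= walk_weight a v s.
Proof.
elim: s a v => [|u s IHs] a v us.
  by apply: Pr_le1; apply: (measurable_determined (@live_determined a v [::])).
move: us => /= /andP[vs us].
rewrite (_ : [set w | _] = [set w | live G mech (rho w) [:: v, u & s]] `&`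
    [set w | turn G mech v (rho w v) a u]); last first.
  by apply/seteqP; split => w; [move=> /andP[]|case=> /= l t; apply/andP].
have := @Pr_determined_rotor (u :: s) (fun r => live G mech r [:: v, u & s])
  v (fun e => turn G mech v e a u) us vs (@live_determined v u s).
move=> /le_trans; apply=> /=.
by rewrite ler_wpM2l ?Pr_ge0// IHs.
Qed.

Lemma sum_turn_prob v a : G v a -> \sum_(u <- nbrs G v) turn_prob v a u <= 1.
Proof.
move=> Gva.
have turnE u : turn_prob v a u =
    \sum_(e <- out G v) (turn G mech v e a u)%:R * (degree G v)%:R^-1.
  rewrite /turn_prob (Pr_split_rotor v); last first.
    exact: (measurable_rotor v (fun e => turn G mech v e a u)).
  rewrite !big_seq; apply: eq_bigr => e; rewrite mem_out// => /andP[/eqP e1 Ge].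
  have ve : out_edges G v e by split=> //; rewrite e1.
  case: (boolP (turn _ _ _ _ _ _)) => te.
    rewrite mul1r -(Pr_rotor ve); congr Pr.
    by apply/seteqP; split => w /=; [case|move=> ->].
  rewrite mul0r (_ : _ `&` _ = set0) ?Pr0//.
  by apply/seteqP; split => w //= [/[swap] ->]; rewrite (negbTE te).
rewrite (eq_bigr _ (fun u _ => turnE u)).
under eq_bigr do rewrite -mulr_suml.
have dv : (0 < degree G v)%N by apply: (@degree_gt0 v (v, a)).
rewrite -mulr_suml ler_pdivrMr ?ltr0n// mul1r.
under eq_bigr do rewrite -natr_sum.
by rewrite -natr_sum ler_nat turn_count.
Qed.

(** Each step multiplies the expected number of walks by at most 1. *)
Lemma sum_walk_weight B n a v : G v a ->
  \sum_(s <- exit_walks G B n v) walk_weight a v s <= 1.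
Proof.
elim: n a v => [|n IHn] a v Gva /=; case: ifP => _;
  rewrite ?big_seq1 ?big_nil ?ler01//.
rewrite big_allpairs_dep /=; apply: le_trans (sum_turn_prob Gva).
rewrite !big_seq; apply: ler_sum => u; rewrite mem_nbrs// => Gvu.
rewrite -mulr_sumr -[leRHS]mulr1 ler_wpM2l ?Pr_ge0// IHn//.
by case: sG => ->.
Qed.

Lemma live_exit_determined (B : {fset V}) x s :
  determined_by B (fun r => live_exit G mech B r x s).
Proof. by move=> r r' rr' /=; rewrite (live_exit_agree _ _ _ _ rr'). Qed.

Lemma sum_Pr_live_exit (B : {fset V}) n x : x \in B ->
  \sum_(s <- exit_walks G B n x) Pr [set w | live_exit G mech B (rho w) x s]
    <= 3.
Proof.
move=> xB; case: n => [|n]; rewrite /= xB /=; first by rewrite big_nil.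
rewrite big_allpairs_dep /=.
apply: (@le_trans _ _ (\sum_(u <- nbrs G x) 1)); last first.
  by rewrite big_const_seq count_predT iter_addr_0 size_map ler_nat; case: (dG x).
rewrite !big_seq; apply: ler_sum => u; rewrite mem_nbrs// => Gxu.
have Gux : G u x by case: sG => ->.
apply: le_trans (sum_walk_weight B n Gux); apply: ler_sum => s _.
case: (boolP (uniq (u :: s))) => us; last first.
  rewrite [X in Pr X](_ : _ = set0) ?Pr0 ?walk_weight_ge0//.
  apply/seteqP; split => w //= /and3P[/and3P[_ + _] _ _].
  by rewrite cons_uniq (negbTE us) andbF.
apply: le_trans (Pr_live_le x us); apply: Pr_le.
- exact: (measurable_determined (@live_exit_determined B x (u :: s))).
- exact: (measurable_determined (@live_determined x u s)).
- by move=> w /= /and3P[/and3P[]].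
Qed.

Definition escape (B : {fset V}) x : set Omega :=
  [set w | exits G mech B (rho w) x != [::]].

Lemma exits_determined (B : {fset V}) x (p : pred (seq V)) :
  determined_by B (fun r => p (exits G mech B r x)).
Proof. by move=> r r' rr' /=; rewrite (exits_agree _ _ _ rr'). Qed.

Lemma measurable_escape B x : measurable (escape B x).
Proof.
exact: (measurable_determined (@exits_determined B x (fun s => s != [::]))).
Qed.

Lemma escapeP B x w :
  escape B x w <-> exists s, live_exit G mech B (rho w) x s.
Proof.
rewrite /escape /= -size_eq0 -lt0n -has_predT; split.
  by case/hasP => v; rewrite mem_undup => /mapP[s]; rewrite mem_live_exits//; exists s.
case=> s ls; apply/hasP; exists (last x s) => //; rewrite mem_undup.
by apply: map_f; rewrite mem_live_exits.
Qed.

Lemma Pr_many_exits (B : {fset V}) x k : x \in B ->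
  k%:R * Pr [set w | (k <= size (exits G mech B (rho w) x))%N] <= 3.
Proof.
move=> xB; apply: le_trans (sum_Pr_live_exit #|` B| xB).
have mE s := measurable_determined (@live_exit_determined B x s).
have mF := measurable_determined
  (@exits_determined B x (fun s => (k <= size s)%N)).
have := @Pr_count _ (exit_walks G B #|` B| x)
  (fun s w => live_exit G mech B (rho w) x s) k _ mE mF.
move=> /(_ _)/le_trans; apply.
  by move=> w /= /leq_trans; apply; rewrite -size_filter size_exits.
apply: ler_sum => s _; apply: Pr_le => //; first exact: measurableI.
Qed.

(** * Escaping from larger and larger neighbourhoods *)

Lemma escape_subset (B B' : {fset V}) x : x \in B -> {subset B <= B'} ->
  escape B' x `<=` escape B x.
Proof.
move=> xB BB' w /escapeP[s /and3P[ls _ lB']]; apply/escapeP.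
have [|s1 [v [s2 [_ ls1]]]] := first_exit xB ls; last by exists (rcons s1 v).
case/lastP: s lB' {ls} => [|s v]; first by rewrite (BB' _ xB).
by rewrite last_rcons has_rcons => vB'; apply/orP; left; apply: contraNN vB' => /BB'.
Qed.

(** On the event that [x] escapes [B] through at most [n] exits, blocking all of
    these exits prevents [x] from escaping [B'], and succeeds with conditional
    probability at least [3^-n]; more than [n] exits have probability at most
    [3 / (n + 1)]. *)
Lemma escape_drop (B B' : {fset V}) x n : x \in B -> {subset B <= B'} ->
  (forall v u, v \in B -> G v u -> u \in B') ->
  3^-1 ^+ n * (Pr (escape B x) - 3 / n.+1%:R) <=
  Pr (escape B x) - Pr (escape B' x).
Proof.
move=> xB BB' nbrB'.
pose p (s : seq V) := (s != [::]) && (size s <= n)%N.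
pose A r := p (exits G mech B r x).
pose k r v := blocker G mech v [set y | exit_edge G mech B r x y v].
have dA : determined_by B A := @exits_determined B x p.
have mA := measurable_determined dA.
have [] := @Pr_block B A (fun r => exits G mech B r x) k n (fset_uniq B) dA.
- move=> r r' rr'; split; first exact: exits_agree.
  by rewrite /k (exit_edge_agree _ _ _ rr').
- move=> r; split; [exact: undup_uniq|exact: exits_notin|by case/andP].
- move=> w v _; have cr : rotor_configuration G (rho w) by case: rhoU.
  by case: (blockerP dG mG [set y | exit_edge G mech B (rho w) x y v]
    (ex_intro _ _ (cr v))).
set K := [set w | {in _, _}] => mK leK.
have mE := measurable_escape B x; have mE' := measurable_escape B' x.
have mAK := measurableI _ _ mA mK.
have disj : ([set w | A (rho w)] `&` K) `&` escape B' x = set0.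
  apply/seteqP; split => w // [[_ Kw] /escapeP[s]].
  apply/negP; apply: (blocked_no_exit sG dG mG _ xB BB' nbrB' Kw).
  by case: rhoU.
have leE : Pr ([set w | A (rho w)] `&` K) + Pr (escape B' x) <= Pr (escape B x).
  rewrite -PrU//; apply: Pr_le => //; first exact: measurableU.
  move=> w [[/= /andP[]//]|]; exact: escape_subset.
rewrite lerBrDr; apply: le_trans leE; rewrite lerD2r; apply: le_trans leK.
rewrite ler_wpM2l ?exprn_ge0 ?invr_ge0// lerBlDr.
pose M := [set w | (n.+1 <= size (exits G mech B (rho w) x))%N].
have mM : measurable M :=
  measurable_determined (@exits_determined B x (fun s => (n < size s)%N)).
apply: (@le_trans _ _ (Pr [set w | A (rho w)] + Pr M)).
  rewrite -PrU//; last first.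
    apply/seteqP; split => w // [/= /andP[_]]; rewrite leqNgt => /negP.
    by [].
  apply: Pr_le => //; first exact: measurableU.
  move=> w /= Ew; rewrite /A /p /M /= Ew /=.
  by case: leqP; [left|right].
by rewrite lerD2l ler_pdivlMr ?ltr0n// mulrC; apply: Pr_many_exits.
Qed.

Fixpoint nbhd (x : V) n : {fset V} :=
  if n is m.+1 then
    (nbhd x m `|` [fset u in flatten [seq nbrs G v | v <- nbhd x m]])%fset
  else [fset x]%fset.

Lemma nbhd_subset x n : {subset nbhd x n <= nbhd x n.+1}.
Proof. by move=> v vB; rewrite /= inE vB. Qed.

Lemma nbhd_nbr x n v u : v \in nbhd x n -> G v u -> u \in nbhd x n.+1.
Proof.
move=> vB Gvu; rewrite /= inE; apply/orP; right; rewrite inE.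
by apply/flattenP; exists (nbrs G v); rewrite ?map_f// mem_nbrs.
Qed.

Lemma nbhd_center x n : x \in nbhd x n.
Proof. by elim: n => [|n IHn]; [rewrite inE|apply: nbhd_subset]. Qed.

Lemma nbhd_path x p n v : v \in nbhd x n -> path G v p ->
  last v p \in nbhd x (n + size p).
Proof.
elim: p n v => [|u p IHp] n v vB /=; first by rewrite addn0.
by case/andP => Gvu up; rewrite addnS -addSn; apply: IHp up; apply: nbhd_nbr Gvu.
Qed.

(** Otherwise the probability of escaping [nbhd x m] would decrease by at least
    the fixed amount [dl] at each step. *)
Lemma escape_forever_negligible x :
  P.-negligible (\bigcap_n escape (nbhd x n) x).
Proof.
have mE n := measurable_escape (nbhd x n) x.
set E := \bigcap_n _.
have mI : measurable E by apply: bigcap_measurable => // n _.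
suff E0 : P E = 0%E by exists E; split.
rewrite PrE//; congr EFin; apply/eqP; rewrite eq_le Pr_ge0 andbT leNgt; apply/negP => q0.
have [n ltn] : exists n, 3 / n.+1%:R < Pr E.
  exists (Num.bound (3 / Pr E)); rewrite ltr_pdivrMr ?ltr0n// mulrC -ltr_pdivrMr//.
  apply: lt_trans (archi_boundP _) _; first by rewrite divr_ge0 ?Pr_ge0.
  by rewrite ltr_nat.
pose dl := 3^-1 ^+ n * (Pr E - 3 / n.+1%:R).
have dl0 : 0 < dl by rewrite mulr_gt0 ?exprn_gt0 ?invr_gt0 ?subr_gt0.
have drop m : Pr (escape (nbhd x m) x) <= 1 - m%:R * dl.
  elim: m => [|m IHm]; first by rewrite mul0r subr0 Pr_le1.
  have := @escape_drop (nbhd x m) (nbhd x m.+1) x n (nbhd_center x m)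
    (@nbhd_subset x m) (@nbhd_nbr x m).
  have leq : Pr E <= Pr (escape (nbhd x m) x).
    by apply: Pr_le => // w; apply.
  have : dl <= 3^-1 ^+ n * (Pr (escape (nbhd x m) x) - 3 / n.+1%:R).
    by rewrite ler_wpM2l ?exprn_ge0 ?invr_ge0// lerD2r.
  move: (3^-1 ^+ n * _) => z; rewrite -natr1; lra.
have := drop (Num.bound (dl^-1)).
have : 1 < (Num.bound dl^-1)%:R * dl.
  by rewrite -ltr_pdivrMr// mul1r archi_boundP// invr_ge0 ltW.
by have := Pr_ge0 (escape (nbhd x (Num.bound dl^-1)) x); lra.
Qed.

End RandomRotors.

Theorem proposition4p1 (V : choiceType) (G : rel V)
    (mech : V -> V * V -> V * V)
    (R : realType) (d : measure_display) (Omega : measurableType d)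
    (P : probability Omega R) (rho : Omega -> V -> V * V) :
  simple_graph G ->
  infinite_set [set: V] ->
  connected_graph G ->
  max_degree_le G 3 ->
  rotor_mechanism G mech ->
  independent_uniform_rotors P G rho ->
  {ae P, forall w, ~ exists x : nat -> V, infinite_live_path G mech (rho w) x}.
Proof.
move=> sG infV conG dG mG rhoU.
have /set0P[c _] : [set: V] != set0.
  by apply/eqP => V0; apply: infV; rewrite V0; apply: finite_set0.
pose E x := \bigcap_n escape G mech rho (nbhd G x n) x.
pose bad := \bigcup_n \bigcup_m E (nth c (nbhd G c n) m).
have badN : P.-negligible bad.
  apply: negligible_bigcup => n; apply: negligible_bigcup => m.
  exact: escape_forever_negligible sG dG mG rhoU _.
apply: negligibleS badN => w /contrapT[x lx].
have [p [pp lp]] := conG c (x 0).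
have xn : x 0 \in nbhd G c (size p).
  by rewrite -lp -[size p]add0n; apply: (nbhd_path dG (nbhd_center G c 0) pp).
(* The vertices are enumerated by a radius and a position in the neighbourhood
   of [c] of that radius; the default [c] of [nth] only repeats a vertex. *)
exists (size p) => //; exists (index (x 0) (nbhd G c (size p))) => //.
rewrite nth_index// => n _; apply/(escapeP mech rho dG).
by apply: infinite_live_path_exits lx _; apply: nbhd_center.
Qed.
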